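(* For any two non-trivial finite simple connected graphs $G$ and $H$, $$\gamma_{P,c}(G\,\square\,H)\leq \min\{Z_c(G)\,\gamma_c(H),\ Z_c(H)\,\gamma_c(G)\}.$$
   Context: Power domination: for $S\subseteq V(G)$, start with $M(S)=N[S]$ and repeatedly add a vertex $w$ whenever some $v\in M(S)$ has $w$ as its unique neighbour outside $M(S)$; $S$ is a connected power dominating set if the final $M(S)$ is $V(G)$ and $\langle S\rangle$ is connected; $\gamma_{P,c}(G)$ is the minimum size of such a set. Zero forcing: colour the vertices of $Z\subseteq V(G)$ black and the rest white; repeatedly, if a black vertex has exactly one white neighbour, that neighbour becomes black. $Z$ is a zero forcing set if eventually all vertices are black; it is a connected zero forcing set if moreover $\langle Z\rangle$ is connected. $Z_c(G)$ is the minimum size of a connected zero forcing set. $\gamma_c(G)$ is the connected domination number. The Cartesian product $G\,\square\,H$ has vertex set $V(G)\times V(H)$, with $(a,b)\sim(x,y)$ iff either $a=x$ and $by\in E(H)$, or $b=y$ and $ax\in E(G)$. *)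

(* Defs.v *)
From mathcomp Require Import all_boot.

Set Implicit Arguments.
Unset Strict Implicit.
Unset Printing Implicit Defensive.

Record sgraph := SGraph {
  vertex :> finType;
  edge : rel vertex;
  edge_sym : symmetric edge;
  edge_irrefl : irreflexive edge
}.

Section Graph.
Variable G : sgraph.
Implicit Types (S M : {set G}) (v w : G).

Definition open_nbhd v : {set G} := [set w | edge v w].

Definition closed_nbhd S : {set G} := S :|: \bigcup_(v in S) open_nbhd v.

(* The empty set counts as connected. No minimum below is affected: in a graph
   with at least one vertex, set0 is neither dominating, nor zero forcing, nor
   power dominating. *)
Definition connected_set S : bool :=
  [forall x in S, forall y in S,
     connect [rel a b | [&& a \in S, b \in S & edge a b]] x y].

Definition connected_graph : bool := connected_set setT.

(* One application of the colour change rule, adding exactly one vertex; it is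
   both the propagation step of power domination and the step of zero forcing. *)
Definition force : rel {set G} := fun M M' =>
  [exists v in M, exists w,
     (open_nbhd v :\: M == [set w]) && (M' == w |: M)].

(* "Some run of the process ends with all vertices". By forces_all_confluent
   below, this does not depend on the order in which vertices are added. *)
Definition forces_all M : bool := connect force M setT.

Definition dominating S : bool := closed_nbhd S == setT.
Definition zero_forcing S : bool := forces_all S.
Definition power_dominating S : bool := forces_all (closed_nbhd S).

Definition connected_dominating S : bool := dominating S && connected_set S.
Definition connected_zero_forcing S : bool :=
  zero_forcing S && connected_set S.
Definition connected_power_dominating S : bool :=
  power_dominating S && connected_set S.

(* The default setT satisfies each of the predicates used below when G is
   connected, so the minimum is then a genuine one (see min_cardP). *)
Definition min_card (P : pred {set G}) : nat :=
  #|[arg min_(S < setT | P S) #|S|]|.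

Definition gamma_c : nat := min_card connected_dominating.
Definition Z_c : nat := min_card connected_zero_forcing.
Definition gamma_Pc : nat := min_card connected_power_dominating.

Lemma min_cardP (P : pred {set G}) : P setT ->
  (exists2 S, P S & #|S| = min_card P) /\
  (forall S, P S -> min_card P <= #|S|).
Proof.
by rewrite /min_card => PT; case: arg_minnP => // S PS leS; split=> //; exists S.
Qed.

Lemma closed_nbhdT : closed_nbhd setT = setT.
Proof. exact: setTU. Qed.

Lemma connected_dominatingT : connected_graph -> connected_dominating setT.
Proof. by rewrite /connected_dominating /dominating closed_nbhdT eqxx. Qed.

Lemma connected_zero_forcingT : connected_graph -> connected_zero_forcing setT.
Proof. by rewrite /connected_zero_forcing /zero_forcing /forces_all connect0. Qed.

Lemma connected_power_dominatingT :
  connected_graph -> connected_power_dominating setT.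
Proof.
by rewrite /connected_power_dominating /power_dominating closed_nbhdT
           /forces_all connect0.
Qed.

Lemma forces_all_sub M (N : {set G}) : M \subset N -> forces_all M -> forces_all N.
Proof.
move=> sMN /connectP[p]; elim: p M N sMN => [|M' p IH] M N sMN /=.
  by move=> _ defM; move: sMN; rewrite -defM subTset => /eqP->; exact: connect0.
case/andP=> /existsP[v /andP[vM /existsP[w /andP[/eqP Dw /eqP defM']]]] pM' lM'.
have [wN|wN] := boolP (w \in N).
  by apply: (IH M') => //; rewrite defM' subUset sub1set wN.
apply: (@connect_trans _ _ (w |: N)); last first.
  by apply: (IH M') => //; rewrite defM' setUS.
apply/connect1/existsP; exists v; rewrite (subsetP sMN) //=.
apply/existsP; exists w; rewrite eqxx andbT eqEsubset -{1}Dw setDS //=.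
rewrite sub1set in_setD wN /=.
by have := set11 w; rewrite -Dw inE => /andP[_].
Qed.

Lemma forces_all_confluent M M' :
  connect force M M' -> forces_all M' = forces_all M.
Proof.
move=> MM'; apply/idP/idP; first exact: connect_trans.
apply: forces_all_sub; case/connectP: MM' => p.
elim: p M => [|N p IH] M /=; first by move=> _ ->.
case/andP=> /existsP[v /andP[_ /existsP[w /andP[_ /eqP defN]]]] pN lN.
by apply: (subset_trans _ (IH N pN lN)); rewrite defN subsetUr.
Qed.

End Graph.

Section CartesianProduct.
Variables G H : sgraph.

Definition cart_edge : rel (G * H) := fun p q =>
  ((p.1 == q.1) && edge p.2 q.2) || ((p.2 == q.2) && edge p.1 q.1).

Lemma cart_edge_sym : symmetric cart_edge.
Proof.
move=> p q; rewrite /cart_edge (eq_sym p.1) (eq_sym p.2).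
by rewrite (edge_sym p.1) (edge_sym p.2).
Qed.

Lemma cart_edge_irrefl : irreflexive cart_edge.
Proof. by move=> p; rewrite /cart_edge !edge_irrefl !andbF. Qed.

Definition cart_prod : sgraph := SGraph cart_edge_sym cart_edge_irrefl.

Lemma connected_cart_prod :
  connected_graph G -> connected_graph H -> connected_graph cart_prod.
Proof.
have eqT (K : sgraph) : connected_graph K <-> forall x y : K, connect (@edge K) x y.
  rewrite /connected_graph /connected_set.
  have E : [rel a b | [&& a \in setT, b \in setT & @edge K a b]] =2 @edge K.
    by move=> a b /=; rewrite !inE.
  split=> [/forall_inP h x y|h].
    by have /forall_inP/(_ y) := h x (in_setT _); rewrite (eq_connect E) => -> //; rewrite inE.
  by apply/forall_inP => x _; apply/forall_inP => y _; rewrite (eq_connect E).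
move=> /eqT cG /eqT cH; apply/eqT => -[a b] [x y].
apply: (@connect_trans _ _ (a, y)).
  case/connectP: (cH b y) => p; elim: p b => [|c p IH] b /=.
    by move=> _ ->; exact: connect0.
  case/andP=> bc pc lc; apply: connect_trans (IH c pc lc).
  by apply: connect1; rewrite /= /cart_edge /= eqxx bc.
case/connectP: (cG a x) => p; elim: p a => [|c p IH] a /=.
  by move=> _ ->; exact: connect0.
case/andP=> ac pc lc; apply: connect_trans (IH c pc lc).
by apply: connect1; rewrite /= /cart_edge /= eqxx ac orbT.
Qed.

End CartesianProduct.

(* Main.v *)
(** If [Z] is zero forcing in [G] and [D] is dominating in [H], then the closed
    neighbourhood of [Z * D] contains [Z * V(H)]. From there the process
    on [Z] runs in all copies of [G] simultaneously: if [v] forces [w] from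
    [M] in [G], then the only neighbour of [(v, h)] outside [M * V(H)] is
    [(w, h)]. The second bound follows since [G * H] and [H * G] are
    isomorphic. *)

Require Import Defs.
From mathcomp Require Import all_boot.

(** Serves both for walks inside induced subgraphs and for runs of the forcing process, where the
    points of the relation are vertex sets. *)
Lemma homo_connect (T T' : finType) (e : rel T) (e' : rel T') (f : T -> T') :
  {homo f : x y / e x y >-> e' x y} ->
  {homo f : x y / connect e x y >-> connect e' x y}.
Proof.
move=> homo_f x y /connectP[p ep ->]; apply/connectP.
by exists (map f p); rewrite ?last_map ?(homo_path homo_f).
Qed.

Lemma connected_setP (G : sgraph) (S : {set G}) :
  reflect {in S &, forall x y,
            connect [rel a b | [&& a \in S, b \in S & edge a b]] x y}
          (connected_set S).
Proof.
apply: (iffP forall_inP) => [cS x y xS | cS x xS].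
  exact/forall_inP/cS.
by apply/forall_inP => y; apply: cS.
Qed.

(** If [w] is already in [M] nothing changes; otherwise this is one genuine force. Unlike the
    equation in [force], the inclusion survives enlarging [M]. *)
Lemma forces_all_step (G : sgraph) (M : {set G}) (v w : G) :
  v \in M -> edge v w -> open_nbhd v \subset w |: M ->
  forces_all (w |: M) -> forces_all M.
Proof.
move=> vM vw sub_v; have [wM|wM] := boolP (w \in M).
  by have /setUidPr -> : [set w] \subset M by rewrite sub1set.
apply/connect_trans/connect1/existsP; exists v.
rewrite vM; apply/existsP; exists w; rewrite eqxx andbT.
by rewrite eqEsubset subDset setUC sub_v sub1set !inE wM.
Qed.

(* The vertices of [W] may be forced one after the other, since a force remains
   valid when [M] grows. *)
Lemma forces_all_steps (G : sgraph) (M W : {set G}) :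
  {in W, forall w, exists v,
     [/\ v \in M, edge v w & open_nbhd v \subset w |: M]} ->
  forces_all (M :|: W) -> forces_all M.
Proof.
move=> forceW; have -> : W = [set:: enum W] by rewrite set_enum.
have : {subset enum W <= W} by move=> w; rewrite mem_enum.
elim: (enum W) => [|w s IH] sW; first by rewrite set_nil setU0.
(* The head [w] is forced last, from [M] together with [s]; the induction hypothesis then removes
   [s]. *)
rewrite set_cons setUCA => all_ws.
have [v [vM vw sub_v]] := forceW w (sW w (mem_head w s)).
apply: IH => [u us|]; first by rewrite sW // inE us orbT.
apply: (@forces_all_step _ _ v w) all_ws => //; first by rewrite inE vM.
by rewrite (subset_trans sub_v) // setUS // subsetUl.
Qed.

Section Product.
Variables G H : sgraph.
Implicit Types (Z : {set G}) (D : {set H}).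

(** The type annotation turns a set of pairs into a vertex set of the product graph. *)
Let prod_set Z D : {set cart_prod G H} := setX Z D.

Lemma forces_all_prod Z : zero_forcing Z -> forces_all (prod_set Z setT).
Proof.
case/connectP=> p; elim: p Z => [|Z' p IH] Z /=.
  move=> _ <-; have -> : prod_set setT setT = setT.
    by apply/setP=> -[a b]; rewrite !inE.
  exact: connect0.
case/andP=> /existsP[v /andP[vZ /existsP[w /andP[/eqP Dw /eqP defZ']]]] pZ' lZ'.
have /setDP[vw _] : w \in open_nbhd v :\: Z by rewrite Dw set11.
(* The whole fibre over [w] is added as one block, each [(w, h)] being forced by [(v, h)]. *)
apply: (@forces_all_steps _ _ (prod_set [set w] setT)) => [[w' h]|].
  rewrite !inE andbT /= => /eqP->; exists (v, h); split.
  - by rewrite !inE vZ.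
  - by rewrite inE in vw; rewrite /= /cart_edge /= vw eqxx orbT.
  apply/subsetP=> -[x y]; rewrite !inE /= /cart_edge /= andbT xpair_eqE.
  (* A neighbour of [(v, h)] lies in the fibre over [v], hence in the current set, or is [(x, h)]
     with [x] adjacent to [v], so that [x] is in [Z] or equals [w]. *)
  case/orP=> /andP[/eqP<- // vx]; first by rewrite vZ orbT.
  rewrite eqxx andbT; have [|xZ] := boolP (x \in Z); first by rewrite orbT.
  by have := set11 w; rewrite -in_set1 -Dw !inE xZ vx.
have -> : prod_set Z setT :|: prod_set [set w] setT = prod_set Z' setT.
  by apply/setP=> -[a b]; rewrite defZ' !inE !andbT orbC.
exact: IH.
Qed.

Lemma power_dominating_prod Z D :
  zero_forcing Z -> dominating D -> power_dominating (prod_set Z D).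
Proof.
move=> zfZ /eqP domD; apply: forces_all_sub (forces_all_prod Z zfZ).
apply/subsetP=> -[a b]; rewrite !inE andbT /= => aZ; rewrite aZ /=.
have: b \in closed_nbhd D by rewrite domD.
rewrite inE => /orP[-> // | /bigcupP[d dD db]].
apply/orP; right; apply/bigcupP; exists (a, d); first by rewrite !inE aZ.
by rewrite inE in db; rewrite inE /= /cart_edge /= eqxx db.
Qed.

Lemma connected_set_prod Z D :
  connected_set Z -> connected_set D -> connected_set (prod_set Z D).
Proof.
move=> /connected_setP cZ /connected_setP cD; apply/connected_setP.
move=> [a b] [c d]; rewrite !inE /= => /andP[aZ bD] /andP[cZ' dD].
(* Walk within the copy of [Z] at height [b], then within the copy of [D] over [c]. *)
apply: (@connect_trans _ _ (c, b)).
  apply: (homo_connect _ _ _ _ (fun x : G => (x, b) : cart_prod G H)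
    _ _ _ (cZ a c aZ cZ')).
  move=> x y /and3P[xZ yZ xy].
  by rewrite /= !inE /= xZ yZ bD /cart_edge /= eqxx xy orbT.
apply: (homo_connect _ _ _ _ (fun y : H => (c, y) : cart_prod G H)
  _ _ _ (cD b d bD dD)).
move=> x y /and3P[xD yD xy].
by rewrite /= !inE /= xD yD cZ' /cart_edge /= eqxx xy.
Qed.

Lemma gamma_Pc_prod_le :
  connected_graph G -> connected_graph H ->
  gamma_Pc (cart_prod G H) <= Z_c G * gamma_c H.
Proof.
move=> cG cH.
have [[Z /andP[zfZ cZ] cardZ] _] := min_cardP (connected_zero_forcingT cG).
have [[D /andP[domD cD] cardD] _] := min_cardP (connected_dominatingT cH).
(* Connectedness of the product makes the default [setT] admissible, so its [min_card] is a true
   minimum. *)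
have [_ min_le] :=
  min_cardP (connected_power_dominatingT (connected_cart_prod cG cH)).
rewrite /Z_c /gamma_c -cardZ -cardD -(cardsX Z D); apply: min_le.
by apply/andP; split;
  [exact: power_dominating_prod | exact: connected_set_prod].
Qed.

End Product.

Section Isomorphism.
Variables (G H : sgraph) (f : G -> H).
Hypotheses (bij_f : bijective f) (edge_f : {mono f : x y / edge x y}).

Let inj_f : injective f := bij_inj bij_f.

Lemma imset_open_nbhd v : f @: open_nbhd v = open_nbhd (f v).
Proof.
have [g fK gK] := bij_f; apply/setP=> y; rewrite -(gK y) mem_imset //.
by rewrite !inE edge_f.
Qed.

Lemma imset_closed_nbhd (S : {set G}) :
  f @: closed_nbhd S = closed_nbhd (f @: S).
Proof.
rewrite /closed_nbhd imsetU; congr (_ :|: _); apply/setP=> y.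
apply/imsetP/bigcupP=> [[x /bigcupP[v vS vx] ->]|[_ /imsetP[v vS ->]]].
  by exists (f v); rewrite ?imset_f // -imset_open_nbhd imset_f.
rewrite -imset_open_nbhd => /imsetP[x vx ->]; exists x => //.
by apply/bigcupP; exists v.
Qed.

Lemma forces_all_imset (M : {set G}) : forces_all M -> forces_all (f @: M).
Proof.
have fT : f @: setT = setT.
  have [g fK gK] := bij_f; apply/setP=> y.
  by rewrite -(gK y) mem_imset // !inE.
(* With the full set of [H] written as an image, both ends of the run are images, and it remains to
   map single forces. *)
rewrite /forces_all -fT.
apply: (homo_connect _ _ _ _ (fun N : {set G} => f @: N)) => {}M M'.
case/existsP=> v /andP[vM /existsP[w /andP[/eqP Dw /eqP->]]].
apply/existsP; exists (f v); rewrite imset_f //; apply/existsP; exists (f w).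
have [g fK gK] := bij_f; rewrite imsetU1 eqxx andbT -imset_set1 -Dw.
apply/eqP/setP=> y; rewrite -(gK y) -imset_open_nbhd.
by rewrite in_setD !mem_imset // in_setD.
Qed.

Lemma connected_set_imset (S : {set G}) :
  connected_set S -> connected_set (f @: S).
Proof.
move=> /connected_setP cS.
apply/connected_setP=> _ _ /imsetP[x xS ->] /imsetP[y yS ->].
apply: (homo_connect _ _ _ _ f _ _ _ (cS x y xS yS)) => a b /and3P[aS bS ab].
by rewrite /= !imset_f // edge_f.
Qed.

(** The image under [f] of a minimum connected power dominating set of [G] is one of [H], of the
    same size by injectivity. *)
Lemma gamma_Pc_iso_le :
  connected_graph G -> connected_graph H -> gamma_Pc H <= gamma_Pc G.
Proof.
move=> cG cH.
have [[S /andP[pdS cS] cardS] _] := min_cardP (connected_power_dominatingT cG).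
have [_ min_le] := min_cardP (connected_power_dominatingT cH).
rewrite {2}/gamma_Pc -cardS -(card_imset S inj_f); apply: min_le.
rewrite /connected_power_dominating connected_set_imset // andbT.
by rewrite /power_dominating -imset_closed_nbhd forces_all_imset.
Qed.

End Isomorphism.

Lemma gamma_Pc_prodC_le (G H : sgraph) :
  connected_graph G -> connected_graph H ->
  gamma_Pc (cart_prod G H) <= gamma_Pc (cart_prod H G).
Proof.
move=> cG cH; have cGH := connected_cart_prod cG cH.
have cHG := connected_cart_prod cH cG.
apply: (@gamma_Pc_iso_le _ _
  (fun p : cart_prod H G => (p.2, p.1) : cart_prod G H)) => //.
  by exists (fun p : cart_prod G H => (p.2, p.1) : cart_prod H G) => -[].
(* Swapping coordinates exchanges the two disjuncts of [cart_edge]. *)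
by move=> p q; rewrite /= /cart_edge /= orbC.
Qed.

Theorem theorem3 (G H : sgraph)
  (ntG : 1 < #|G|) (ntH : 1 < #|H|)
  (cG : connected_graph G) (cH : connected_graph H) :
  gamma_Pc (cart_prod G H) <= minn (Z_c G * gamma_c H) (Z_c H * gamma_c G).
Proof.
rewrite leq_min gamma_Pc_prod_le //=.
exact: leq_trans (gamma_Pc_prodC_le _ _ cG cH) (gamma_Pc_prod_le _ _ cH cG).
Qed.
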